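(* Let $n\ge 3$, let $K\subset\mathbb H^2$ be compact, let $m$ be an integer with $m>\frac n2$ and $k=n-m\ge 1$, and let $0<c\le C<\infty$ be fixed constants. For each $M>0$, let $F_M(X,Z)$ be a stable, totally complex real binary form of degree $2n$ whose upper-half-plane roots satisfy $$\alpha_i^{(M)}=x_i^{(M)}+iy_i^{(M)}\in K,\qquad i=1,\ldots,m,$$ and $$\alpha_{m+j}^{(M)}=-M+iy_{j,M},\qquad y_{j,M}\in[c,C],\qquad j=1,\ldots,k .$$ Then: (1) There exists a compact set $K'=K'(K,n)\subset\mathbb H^2$, depending only on $K$ and $n$, such that $\xi_{\mathcal J}(F_M)\in K'$ for all $M>0$. (2) Write $\xi_{\mathcal H}(F_M)=t_M+iu_M$. Then there are constants $0<c_1<c_2<\infty$ and $c_3>0$, depending only on $K,n,c,C$, such that for all sufficiently large $M$, $$c_1M\le |t_M|\le c_2M,\qquad u_M\ge c_3M .$$ In particular, $$\frac{\operatorname{Im}\xi_{\mathcal J}(F_M)}{\operatorname{Im}\xi_{\mathcal H}(F_M)}\longrightarrow 0\qquad (M\to\infty).$$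
   Context: $\mathbb H^2=\{x+iy:y>0\}$ is the upper half-plane with hyperbolic distance $d_H$, $\cosh d_H(x+iy,u+iv)=1+\frac{(x-u)^2+(y-v)^2}{2yv}$. A real binary form of degree $2n$ is totally complex if it has no real roots (in $\mathbb P^1(\mathbb R)$); then $F(X,Z)=a_0\prod_{i=1}^n (X-\alpha_iZ)(X-\overline{\alpha_i}Z)$ with $a_0\in\mathbb R\setminus\{0\}$, and $\alpha_1,\ldots,\alpha_n\in\mathbb H^2$ are its upper-half-plane roots (with multiplicity). A form of degree $N$ is stable if none of its roots has multiplicity at least $N/2$. Julia's zero $\xi_{\mathcal J}(F)$: let $\mathbb H^3=\{z+t\mathbf{j}: z\in\mathbb C,\ t>0\}$, with $\mathbb H^2\subset\mathbb H^3$ via $x+iy\mapsto x+y\mathbf{j}$, and for $w=z+t\mathbf{j}$, $\alpha\in\mathbb C$ put $d_H(w,\alpha)=\ln\frac{|z-\alpha|^2+t^2}{t}$. For stable $F$ with all complex roots $\beta_1,\ldots,\beta_{2n}$ (with multiplicity), $\xi_{\mathcal J}(F)$ is the unique point $w\in\mathbb H^3$ minimizing $\sum_{i=1}^{2n} d_H(w,\beta_i)$; for totally complex real $F$ it lies in $\mathbb H^2$. Hyperbolic zero $\xi_{\mathcal H}(F)$: it is the hyperbolic center of mass of $\alpha_1,\ldots,\alpha_n$, i.e. the unique point $Q\in\mathbb H^2$ minimizing $\sum_{i=1}^n\cosh d_H(Q,\alpha_i)$. *)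

(* Defs.v *)
From HB Require Import structures.
From mathcomp Require Import all_boot all_order all_algebra.
From mathcomp Require Import complex.
(* mpoly has to be imported before the analysis files: in the other order
   their notations clash. *)
From mathcomp Require Import mpoly.
From mathcomp Require Import all_classical all_reals all_analysis.

Set Implicit Arguments.
Unset Strict Implicit.
Unset Printing Implicit Defensive.

Import Order.TTheory GRing.Theory Num.Theory.
Import numFieldNormedType.Exports.

Local Open Scope ring_scope.
Local Open Scope classical_set_scope.

Section Hyperbolic.
Variable R : realType.

(* A point x + iy of the upper half-plane is the pair (x, y) : R * R. *)
Definition H2 : set (R * R) := [set p | 0 < p.2].

Definition toC (p : R * R) : R[i] := Complex p.1 p.2.

Definition coshR (x : R) : R := (expR x + expR (- x)) / 2.

Definition arcosh (c : R) : R := ln (c + Num.sqrt (c ^+ 2 - 1)).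

Definition dH (p q : R * R) : R :=
  arcosh (1 + ((p.1 - q.1) ^+ 2 + (p.2 - q.2) ^+ 2) / (2 * p.2 * q.2)).

Lemma coshR_arcosh (c : R) : 1 <= c -> coshR (arcosh c) = c.
Proof.
move=> c1; have c0 : 0 < c by apply: lt_le_trans c1.
have d0 : 0 <= c ^+ 2 - 1 by rewrite subr_ge0 expr_ge1// ltW.
rewrite /coshR /arcosh; set s := Num.sqrt _.
have s0 : 0 <= s by exact: sqrtr_ge0.
have cs0 : 0 < c + s by rewrite ltr_wpDr.
rewrite expRN lnK ?posrE//.
have -> : (c + s)^-1 = c - s.
  apply: (mulfI (lt0r_neq0 cs0)); rewrite mulfV ?lt0r_neq0//.
  by rewrite mulrC -subr_sqr sqr_sqrtr// opprB addrCA subrr addr0.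
by rewrite addrACA subrr addr0 -mulr2n -[c *+ 2]mulr_natr mulfK// pnatr_eq0.
Qed.

Lemma coshR_dH (p q : R * R) : H2 p -> H2 q ->
  coshR (dH p q) =
  1 + ((p.1 - q.1) ^+ 2 + (p.2 - q.2) ^+ 2) / (2 * p.2 * q.2).
Proof.
rewrite /H2 /= => p0 q0; apply: coshR_arcosh.
by rewrite lerDl divr_ge0 ?addr_ge0 ?sqr_ge0// ltW// !mulr_gt0.
Qed.

Lemma dH_ge0 (p q : R * R) : H2 p -> H2 q -> 0 <= dH p q.
Proof.
rewrite /H2 /= => p0 q0; apply: ln_ge0.
rewrite -[leLHS]addr0 lerD ?sqrtr_ge0// lerDl.
by rewrite divr_ge0 ?addr_ge0 ?sqr_ge0// ltW// !mulr_gt0.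
Qed.

(* A point z + t j of hyperbolic 3-space is the pair (z, t) : R[i] * R. *)
Definition H3 : set (R[i] * R) := [set w | 0 < w.2].

(* x + iy |-> x + y j *)
Definition H2_to_H3 (p : R * R) : R[i] * R := (real_complex R p.1, p.2).

Definition dH3 (w : R[i] * R) (a : R[i]) : R :=
  ln ((ComplexField.Normc.normc (w.1 - a) ^+ 2 + w.2 ^+ 2) / w.2).

(* A binary form F(X, Z) of degree d is a d-homogeneous element of
   {mpoly R[2]}, with 'X_0 for X and 'X_1 for Z. *)
Definition complexify (F : {mpoly R[2]}) : {mpoly R[i][2]} :=
  map_mpoly (real_complex R) F.

(* The linear form b X - a Z, which vanishes at the point [a : b] of P^1(C). *)
Definition linear_form (a b : R[i]) : {mpoly R[i][2]} :=
  b%:MP * 'X_0 - a%:MP * 'X_1.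

Definition totally_complex (F : {mpoly R[2]}) : Prop :=
  forall x z : R, (x, z) != (0, 0) -> F.@[tnth [tuple x; z]] != 0.

(* The root [a : b] of a form G has multiplicity at least e. *)
Definition root_mult_ge (G : {mpoly R[i][2]}) (a b : R[i]) (e : nat) : Prop :=
  exists G', G = linear_form a b ^+ e * G'.

Definition stable (d : nat) (F : {mpoly R[2]}) : Prop :=
  forall a b : R[i], (a, b) != (0, 0) ->
  forall e : nat, (0 < e)%N -> root_mult_ge (complexify F) a b e -> (2 * e < d)%N.

(* s lists the complex roots of F with multiplicity, [1 : 0] not being one. *)
Definition complex_roots (F : {mpoly R[2]}) (s : seq R[i]) : Prop :=
  exists2 a0 : R[i], a0 != 0 &
    complexify F = a0%:MP * \prod_(b <- s) linear_form b 1.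

(* F is totally complex and s lists its upper half-plane roots, with
   multiplicity. *)
Definition uhp_roots (F : {mpoly R[2]}) (s : seq (R * R)) : Prop :=
  (forall p, p \in s -> H2 p) /\
  exists2 a0 : R, a0 != 0 &
    complexify F = (real_complex R a0)%:MP *
      \prod_(p <- s) (linear_form (toC p) 1 * linear_form (conjc (toC p)) 1).

Definition julia_minimizer (F : {mpoly R[2]}) (w : R[i] * R) : Prop :=
  H3 w /\
  exists2 s, complex_roots F s &
    forall w', H3 w' -> \sum_(b <- s) dH3 w b <= \sum_(b <- s) dH3 w' b.

(* The default value (0, 0) is not in H3, so [H3 (julia_zero F)] holds exactly
   when a minimizer exists. *)
Definition julia_zero (F : {mpoly R[2]}) : R[i] * R :=
  xget (0, 0) [set w | julia_minimizer F w].

Definition hyperbolic_center (F : {mpoly R[2]}) (q : R * R) : Prop :=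
  H2 q /\
  exists2 s, uhp_roots F s &
    forall q', H2 q' ->
      \sum_(a <- s) coshR (dH q a) <= \sum_(a <- s) coshR (dH q' a).

(* As above, the default value (0, 0) is not in H2. *)
Definition hyperbolic_zero (F : {mpoly R[2]}) : R * R :=
  xget (0, 0) [set q | hyperbolic_center F q].

(* The forms F M, M > 0, have m upper half-plane roots in K and n - m of the
   form - M + i y with y in [c, C]. *)
Definition root_escaping_family (n m : nat) (K : set (R * R)) (c C : R)
    (F : R -> {mpoly R[2]}) : Prop :=
  forall M : R, 0 < M ->
  [/\ F M \is (2 * n).-homog, stable (2 * n) (F M), totally_complex (F M) &
    exists alpha : n.-tuple (R * R),
    [/\ uhp_roots (F M) alpha,
        forall i : 'I_n, (i < m)%N -> K (tnth alpha i) &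
        forall i : 'I_n, (m <= i)%N ->
          (tnth alpha i).1 = - M /\ c <= (tnth alpha i).2 <= C]].

End Hyperbolic.

(* Main.v *)
Require Import Defs.
From HB Require Import structures.
From mathcomp Require Import all_boot all_order all_algebra.
From mathcomp Require Import complex.
From mathcomp Require Import mpoly.
From mathcomp Require Import ring lra.
From mathcomp Require Import all_classical all_reals all_analysis.
Import Order.TTheory GRing.Theory Num.Theory.
Import numFieldNormedType.Exports.
Local Open Scope ring_scope.
Local Open Scope classical_set_scope.
Set Implicit Arguments.
Unset Strict Implicit.
Unset Printing Implicit Defensive.

(** Both zeros minimize a sum over the roots, and the two cost functions grow
    differently.  With cdist p q = cosh d_H(p, q), the Julia cost of a point of
    H^2 is 2 * \sum ln (cdist w a) up to a constant, so a root far away enters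
    only through its distance; the hyperbolic zero minimizes \sum cdist w a,
    where a root far away enters exponentially in its distance.

    Julia's zero.  Projecting a point z + t j of H^3 orthogonally onto H^2 (to
    its foot) does not raise the contribution of any pair of conjugate roots,
    and lowers that of every pair whose upper root is not the foot, unless z is
    already real [foot_leif]; stability excludes that all upper roots coincide,
    so every minimizer lies in H^2.  In H^2, moving w away from
    p raises the term of each root near p and lowers the other terms by at most
    as much, up to constants, so a strict majority of roots near p confines all
    minimizers to a ball about p whose radius depends only on the degree and on
    the meaning of near [ln_cdist_coercive].  On that ball a minimum exists by
    compactness.

    The hyperbolic zero.  The cost is an explicit function of w = x + iy: if
    the root a is given the weight 1 / Im a, and t and V are the weighted means
    of Re a and of (Re a - t)^2 + (Im a)^2, then it is proportional to
    ((x - t)^2 + y^2 + V) / y.  Hence the zero is t + i sqrt V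
    [hyperbolic_zeroE].  All weights are comparable, so a single root at real
    part - M pulls t below a negative multiple of M, and then a single root
    that stays behind already makes V of order M^2. *)

(** * Uniqueness of the lists of roots *)

Section RootLists.
Variable R : realType.
Implicit Types (F : {mpoly R[2]}) (s : seq (R * R)).

(** Setting (X, Z) = ('X, 1) turns a factorization of a form into one of a
    polynomial in one variable, where factorization is unique. *)
Definition dehomog : {mpoly R[i][2]} -> {poly R[i]} :=
  mmap (@polyC R[i]) (fun i : 'I_2 => if i == 0 then 'X else 1).

Lemma dehomog_prod a0 (s : seq R[i]) :
  dehomog (a0%:MP * \prod_(b <- s) linear_form b 1) =
  a0 *: \prod_(b <- s) ('X - b%:P).
Proof.
rewrite /dehomog rmorphM rmorph_prod /= mmapC -mul_polyC; congr (_ * _).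
apply: eq_bigr => b _.
by rewrite /linear_form rmorphB !rmorphM /= !mmapC !mmapX !mmap1U/= mul1r mulr1.
Qed.

Lemma complex_roots_unique F (s1 s2 : seq R[i]) :
  complex_roots F s1 -> complex_roots F s2 -> perm_eq s1 s2.
Proof.
move=> [a a0 eF] [b b0]; rewrite eF => /(congr1 dehomog).
rewrite !dehomog_prod => e.
have ab : a = b.
  move/(congr1 lead_coef): e.
  by rewrite !lead_coefZ !(eqP (monic_prod_XsubC _ _ _)) !mulr1.
by apply: prod_XsubC_eq; apply: (scalerI a0); rewrite e ab.
Qed.

Definition conj_pair (p : R * R) : seq R[i] := [:: toC p; conjc (toC p)].

Lemma uhp_complex_roots F s :
  uhp_roots F s -> complex_roots F (flatten (map conj_pair s)).
Proof.
move=> [_ [a a0 eF]]; exists (real_complex R a).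
  by apply: contra a0 => /eqP[->].
rewrite eF big_flatten big_map; congr (_ * _); apply: eq_bigr => p _.
by rewrite big_cons big_seq1.
Qed.

(** The upper half-plane roots are recovered from the complex roots by keeping
    those of positive imaginary part. *)
Lemma uhp_roots_unique F s1 s2 :
  uhp_roots F s1 -> uhp_roots F s2 -> perm_eq s1 s2.
Proof.
move=> h1 h2.
have := complex_roots_unique (uhp_complex_roots h1) (uhp_complex_roots h2).
move/(perm_filter (fun z : R[i] => 0 < complex.Im z)).
have flt s : (forall p, p \in s -> H2 p) ->
    [seq z <- flatten (map conj_pair s) | 0 < complex.Im z] = map (@toC R) s.
  elim: s => //= p s IH h.
  have p0 : 0 < p.2 by apply: h; rewrite mem_head.
  rewrite {1 2}/toC /= p0 ltNge oppr_le0 (ltW p0) /= IH // => q qs.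
  by apply: h; rewrite in_cons qs orbT.
rewrite !flt; [|exact: h2.1|exact: h1.1].
by apply: perm_map_inj => -[a b] [c d] [-> ->].
Qed.

(** If all upper roots were equal to p, then p would be a root of multiplicity
    half the degree. *)
Lemma stable_not_constant n F s p :
  stable (2 * n) F -> uhp_roots F s -> size s = n -> (0 < n)%N ->
  {in s, forall q, q = p} -> False.
Proof.
move=> st [_ [a a0 e]] sn n0 sp.
have := st (toC p) 1 _ n n0; rewrite ltnn => st'.
suff : false by [].
apply: st'; first by rewrite xpair_eqE oner_eq0 andbF.
rewrite /root_mult_ge e big_seq.
rewrite (eq_bigr (fun=> linear_form (toC p) 1 * linear_form (conjc (toC p)) 1));
  last by move=> q /sp ->.
rewrite -big_seq big_const_seq count_predT sn iter_mulr mulr1 exprMn.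
exists ((real_complex R a)%:MP * linear_form (conjc (toC p)) 1 ^+ n).
by rewrite mulrCA.
Qed.

End RootLists.

(** * The hyperbolic cosine of the distance *)

Section HyperbolicPlane.
Variable R : realType.
Implicit Types (p q r a w : R * R) (s : seq (R * R)).

(** This is cosh d_H(p, q); the form is
    1 + ((p.1 - q.1)^2 + (p.2 - q.2)^2) / (2 p.2 q.2) over a common
    denominator. *)
Definition cdist p q : R :=
  ((p.1 - q.1) ^+ 2 + p.2 ^+ 2 + q.2 ^+ 2) / (2 * p.2 * q.2).

Lemma coshR_dHE p q : H2 p -> H2 q -> coshR (dH p q) = cdist p q.
Proof.
move=> p0 q0; rewrite coshR_dH // /cdist.
by move: p0 q0; rewrite /H2/= => p0 q0; field; rewrite !gt_eqF.
Qed.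

Lemma cdistC p q : cdist p q = cdist q p.
Proof.
rewrite /cdist; congr (_ / _); last by rewrite mulrAC.
by rewrite -sqrrN opprB addrAC.
Qed.

Lemma cdist_ge1 p q : H2 p -> H2 q -> 1 <= cdist p q.
Proof.
rewrite /H2/cdist/= => p0 q0; rewrite ler_pdivlMr ?mulr_gt0 // mul1r.
have := sqr_ge0 (p.1 - q.1); have := sqr_ge0 (p.2 - q.2); nra.
Qed.

Lemma cdist_gt0 p q : H2 p -> H2 q -> 0 < cdist p q.
Proof. by move=> p0 q0; apply: lt_le_trans (cdist_ge1 p0 q0). Qed.

(** The triangle inequality for d_H, weakened by
    cosh (a + b) <= 2 cosh a cosh b.  In this form it is a polynomial
    inequality whose defect is a sum of squares. *)
Lemma cdist_triangle p q r : H2 p -> H2 q -> H2 r ->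
  cdist p q <= 2 * cdist p r * cdist r q.
Proof.
rewrite /H2/cdist/=; case: p q r => [x y] [u v] [c d] /= y0 v0 d0.
have -> : 2 * (((x - c) ^+ 2 + y ^+ 2 + d ^+ 2) / (2 * y * d)) *
    (((c - u) ^+ 2 + d ^+ 2 + v ^+ 2) / (2 * d * v)) =
    ((((x - c) ^+ 2 + y ^+ 2 + d ^+ 2) * ((c - u) ^+ 2 + d ^+ 2 + v ^+ 2))
    / d ^+ 2) / (2 * y * v) by field; rewrite !gt_eqF.
rewrite ler_pM2r ?invr_gt0 ?mulr_gt0 // ler_pdivlMr ?exprn_gt0 // -subr_ge0.
have -> : ((x - c) ^+ 2 + y ^+ 2 + d ^+ 2) * ((c - u) ^+ 2 + d ^+ 2 + v ^+ 2)
   - ((x - u) ^+ 2 + y ^+ 2 + v ^+ 2) * d ^+ 2 =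
   ((x - c) * (c - u) - d ^+ 2) ^+ 2 + ((x - c) * v) ^+ 2 +
   (y * (c - u)) ^+ 2 + (y * v) ^+ 2 by ring.
by rewrite !addr_ge0 ?sqr_ge0.
Qed.

(** Let L = ln (cdist w p).  Passing from p to w, the term of a root near p
    rises by at least L - B and any other term drops by at most L + B, where
    B = ln (2 k^2).  If the near roots are a strict majority, the total change
    is at least L - B * size s, so the sum can fail to rise only if
    L <= B * size s. *)
Lemma ln_cdist_coercive s p w (k : R) :
  {in s, forall a, H2 a} -> H2 p -> H2 w -> 1 <= k ->
  (size s < 2 * count (fun a => cdist p a <= k)%R s)%N ->
  \sum_(a <- s) ln (cdist w a) <= \sum_(a <- s) ln (cdist p a) ->
  cdist w p <= (2 * k ^+ 2) ^+ size s.
Proof.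
move=> sH pH wH k1 maj le_sum.
have k0 : 0 < k by apply: lt_le_trans k1.
have k20 : 0 < 2 * k ^+ 2 by rewrite mulr_gt0 ?exprn_gt0.
have lnMp (x y : R) : 0 < x -> 0 < y -> ln (x * y) = ln x + ln y.
  by move=> x0 y0; rewrite lnM ?posrE.
pose near a := cdist p a <= k.
set L := ln (cdist w p); set B := ln (2 * k ^+ 2).
have L0 : 0 <= L by apply/ln_ge0/cdist_ge1.
have E0 := cdist_gt0 wH pH.
have pt a : a \in s ->
    (if near a then L else - L) - B <= ln (cdist w a) - ln (cdist p a).
  move=> /sH aH; have wa0 := cdist_gt0 wH aH; have pa0 := cdist_gt0 pH aH.
  have pa1 := cdist_ge1 pH aH; have wa1 := cdist_ge1 wH aH.
  have E1 := cdist_ge1 wH pH.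
  case: ifP => [na|_].
    suff : ln (cdist w p * cdist p a) <= ln (2 * k ^+ 2 * cdist w a).
      by rewrite (lnMp _ _ E0 pa0) (lnMp _ _ k20 wa0) -/L -/B; lra.
    rewrite ler_ln ?posrE;
      [|exact: mulr_gt0 E0 pa0|exact: mulr_gt0 k20 wa0].
    have := cdist_triangle wH pH aH; rewrite [cdist a p]cdistC => tr.
    rewrite expr2 mulrA; move: na; rewrite /near => na.
    apply: (le_trans (ler_wpM2r (ltW pa0) tr)).
    have -> : 2 * cdist w a * cdist p a * cdist p a =
      cdist p a * cdist p a * (2 * cdist w a) by ring.
    have -> : 2 * k * k * cdist w a = k * k * (2 * cdist w a) by ring.
    apply: ler_wpM2r; first by rewrite pmulr_rge0 // ltW.
    by apply: ler_pM => //; exact: ltW.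
  suff : ln (cdist p a) <= ln (2 * k ^+ 2 * (cdist w p * cdist w a)).
    by rewrite (lnMp _ _ k20 (mulr_gt0 E0 wa0)) (lnMp _ _ E0 wa0) -/L -/B; lra.
  rewrite ler_ln ?posrE;
    [|exact: pa0|exact: mulr_gt0 k20 (mulr_gt0 E0 wa0)].
  have := cdist_triangle pH aH wH; rewrite [cdist p w]cdistC => tr.
  apply: (le_trans tr).
  rewrite -mulrA -[leRHS]mulrA ler_pM2l // ler_peMl ?exprn_ege1 //.
  exact: ltW (mulr_gt0 E0 wa0).
have sums : \sum_(a <- s) ((if near a then L else - L) - B) <= 0.
  rewrite big_seq; apply: le_trans (ler_sum _ pt) _.
  by rewrite -big_seq sumrB subr_le0.
have sgn_sum : \sum_(a <- s) ((if near a then L else - L) - B) =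
    (2 * count near s)%:R * L - (size s)%:R * L - (size s)%:R * B.
  elim: (s) => [|a t IH]; first by rewrite big_nil /= muln0 !mul0r !subrr.
  rewrite big_cons IH /= !natrM !natrD -!natr1.
  by case: (near a) => /=; ring.
have : (size s).+1%:R * L <= (2 * count near s)%:R * L.
  by rewrite ler_wpM2r // ler_nat.
rewrite -natr1 => cnt.
have : ln (cdist w p) <= ln ((2 * k ^+ 2) ^+ size s).
  rewrite lnXn // -/L -/B -mulr_natl; move: sums; rewrite sgn_sum.
  move: cnt; rewrite mulrDl mul1r; lra.
by rewrite ler_ln ?posrE ?exprn_gt0.
Qed.

Definition hball p (r : R) : set (R * R) := [set w | H2 w /\ cdist w p <= r].

(** Clearing the denominator describes the ball by a closed condition on the
    whole plane, which forces positive height by itself. *)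
Lemma hball_compact p (r : R) : H2 p -> 0 < r -> compact (hball p r).
Proof.
move=> p0 r0; have pp : 0 < p.2 := p0.
have -> : hball p r = [set w : R * R |
    (w.1 - p.1) ^+ 2 + w.2 ^+ 2 + p.2 ^+ 2 - r * (2 * w.2 * p.2) <= 0].
  apply/seteqP; split=> [w [w0]|w] /=.
    by rewrite /cdist ler_pdivrMr ?subr_le0 // !mulr_gt0.
  rewrite subr_le0 => h; suff w0 : H2 w.
    by split=> //; rewrite /cdist ler_pdivrMr // !mulr_gt0.
  have : 0 < r * (2 * w.2 * p.2).
    by apply: lt_le_trans h; rewrite ltr_wpDl ?addr_ge0 ?sqr_ge0 ?exprn_gt0.
  by rewrite pmulr_rgt0 // pmulr_lgt0 // pmulr_rgt0.
set b := 2 * r * p.2; have b0 : 0 < b by rewrite !mulr_gt0.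
apply: (@subclosed_compact _ _ (`[p.1 - b, p.1 + b] `*` `[0, b])).
- rewrite (_ : mkset _ = (fun w : R * R => (w.1 - p.1) ^+ 2 + w.2 ^+ 2 +
      p.2 ^+ 2 - r * (2 * w.2 * p.2)) @^-1` [set x | x <= 0]) //.
  apply: closed_comp; last exact: closed_le.
  move=> w _; apply: cvgB.
    apply: cvgD; last exact: cvg_cst.
    apply: cvgD.
      by apply: cvgM; apply: cvgB; do ?exact: cvg_cst; exact: cvg_fst.
    by apply: cvgM; exact: cvg_snd.
  apply: cvgM; first exact: cvg_cst.
  apply: cvgM; last exact: cvg_cst.
  by apply: cvgM; [exact: cvg_cst|exact: cvg_snd].
- by apply: compact_setX; exact: segment_compact.
- move=> [x y] /= h; have x2 := sqr_ge0 (x - p.1); have y2 := sqr_ge0 y.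
  have p2 : 0 < p.2 ^+ 2 by rewrite exprn_gt0.
  have yb : r * (2 * y * p.2) = b * y by rewrite /b; ring.
  rewrite yb in h.
  have y0 : 0 <= y.
    rewrite leNgt; apply/negP => y0.
    have : b * y < 0 by rewrite pmulr_rlt0.
    lra.
  have yleb : y <= b.
    rewrite leNgt; apply/negP => yb'.
    have : b * y <= y * y by rewrite ler_wpM2r // ltW.
    by rewrite -expr2; lra.
  have : (x - p.1) ^+ 2 <= b ^+ 2.
    have : b * y <= b * b by rewrite ler_pM2l.
    by rewrite -(expr2 b); lra.
  move=> x2b; rewrite !in_itv /= y0 yleb; split=> //.
  by apply/andP; split; nra.
Qed.

End HyperbolicPlane.

(** * Julia's zero *)

Section JuliaZero.
Variable R : realType.
Implicit Types (F : {mpoly R[2]}) (p a : R * R) (w : R[i] * R).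
Implicit Types (s : seq (R * R)).

Definition dH3_pair w a : R := dH3 w (toC a) + dH3 w (conjc (toC a)).

(** The orthogonal projection of H^3 onto H^2: the geodesic through w
    orthogonal to H^2 is a half-circle centred at the boundary point Re w.1, and
    the foot is its top. *)
Definition foot w : R * R :=
  (complex.Re w.1, Num.sqrt (complex.Im w.1 ^+ 2 + w.2 ^+ 2)).

Lemma foot_H2 w : H3 w -> H2 (foot w).
Proof.
by rewrite /H3/H2/= => t0; rewrite sqrtr_gt0 ltr_wpDl ?sqr_ge0 ?exprn_gt0.
Qed.

Lemma normc2 (z : R[i]) :
  ComplexField.Normc.normc z ^+ 2 = complex.Re z ^+ 2 + complex.Im z ^+ 2.
Proof. by case: z => x y /=; rewrite sqr_sqrtr // addr_ge0 ?sqr_ge0. Qed.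

Lemma dH3_pairE (x y t : R) a : 0 < t ->
  dH3_pair (Complex x y, t) a =
  ln ((((x - a.1) ^+ 2 + (y - a.2) ^+ 2 + t ^+ 2) *
       ((x - a.1) ^+ 2 + (y + a.2) ^+ 2 + t ^+ 2)) / t ^+ 2).
Proof.
move=> t0; have t20 : 0 < t ^+ 2 by rewrite exprn_gt0.
rewrite /dH3_pair /dH3 !normc2 /= opprK -lnM ?posrE.
- by congr ln; field; rewrite gt_eqF.
- by rewrite divr_gt0 // ltr_wpDl // addr_ge0 ?sqr_ge0.
- by rewrite divr_gt0 // ltr_wpDl // addr_ge0 ?sqr_ge0.
Qed.

Lemma dH3_pair_H2 p a : H2 p -> H2 a ->
  dH3_pair (H2_to_H3 p) a = 2 * ln (2 * a.2) + 2 * ln (cdist p a).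
Proof.
move=> pH aH; have cd := cdist_gt0 pH aH.
move: (pH) (aH); rewrite /H2 /= => p0 a0.
have a20 : 0 < 2 * a.2 by rewrite pmulr_rgt0.
rewrite dH3_pairE //= -mulrDr -lnM ?posrE // mulr_natl -lnXn ?(mulr_gt0 a20) //.
by congr ln; rewrite /cdist; field; rewrite !gt_eqF.
Qed.

(** With w = x + iy + t j, foot (x, T) and root a + ib, the exponentials of the
    two sides differ by
    (y / (t T))^2 * ((x - a)^2 + (b - T)^2) * ((x - a)^2 + (b + T)^2),
    which is nonnegative and vanishes only in the two listed cases. *)
Lemma foot_leif w a : H3 w -> H2 a ->
  dH3_pair (H2_to_H3 (foot w)) a <= dH3_pair w a
    ?= iff (complex.Im w.1 == 0) || (a == foot w).
Proof.
case: w a => [[x y] t] [a b]; rewrite /H3/H2/= => t0 b0.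
have t20 : 0 < t ^+ 2 by rewrite exprn_gt0.
set T := Num.sqrt (y ^+ 2 + t ^+ 2).
have T2 : T ^+ 2 = y ^+ 2 + t ^+ 2 by rewrite sqr_sqrtr // addr_ge0 ?sqr_ge0.
have T0 : 0 < T by rewrite sqrtr_gt0 ltr_wpDl ?sqr_ge0.
have T20 : 0 < T ^+ 2 by rewrite exprn_gt0.
rewrite /foot /H2_to_H3 /= -/T !dH3_pairE //=.
set A := (X in ln X <= _ ?= iff _); set B := (X in ln A <= ln X ?= iff _).
have A0 : 0 < A.
  by rewrite divr_gt0 // mulr_gt0 // ltr_wpDl // addr_ge0 ?sqr_ge0.
have B0 : 0 < B.
  by rewrite divr_gt0 // mulr_gt0 // ltr_wpDl // addr_ge0 ?sqr_ge0.
pose S := (x - a) ^+ 2 + b ^+ 2 + T ^+ 2.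
have BA : B - A = (y / (t * T)) ^+ 2 *
    ((x - a) ^+ 2 + (b - T) ^+ 2) * ((x - a) ^+ 2 + (b + T) ^+ 2).
  have y2 : y ^+ 2 = T ^+ 2 - t ^+ 2 by rewrite T2 addrK.
  have -> : B = (S ^+ 2 - 4 * y ^+ 2 * b ^+ 2) / t ^+ 2.
    by rewrite /S T2 /B; congr (_ / _); ring.
  rewrite expr_div_n y2 /A /S; field.
  by rewrite !gt_eqF.
have q0 : 0 < (x - a) ^+ 2 + (b + T) ^+ 2.
  by rewrite ltr_wpDl ?sqr_ge0 // exprn_gt0 // addr_gt0.
split.
  rewrite ler_ln ?posrE // -subr_ge0 BA.
  apply: mulr_ge0 (ltW q0); apply: mulr_ge0; first exact: sqr_ge0.
  by apply: addr_ge0; exact: sqr_ge0.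
have -> : (ln A == ln B) = (B - A == 0).
  rewrite subr_eq0; apply/eqP/eqP => [|-> //].
  by move/ln_inj; rewrite !posrE => ->.
rewrite BA mulf_eq0 (gt_eqF q0) orbF mulf_eq0 sqrf_eq0.
rewrite mulf_eq0 invr_eq0 (gt_eqF (mulr_gt0 t0 T0)) orbF.
congr (_ || _); rewrite paddr_eq0 ?sqr_ge0 // !sqrf_eq0 !subr_eq0.
by rewrite xpair_eqE [a == x]eq_sym.
Qed.

Lemma julia_minimizer_uhp F s w : uhp_roots F s -> julia_minimizer F w <->
  H3 w /\ forall w', H3 w' ->
    \sum_(a <- s) dH3_pair w a <= \sum_(a <- s) dH3_pair w' a.
Proof.
move=> Fs; have Fz := uhp_complex_roots Fs.
have sumE w' : \sum_(b <- flatten (map (@conj_pair R) s)) dH3 w' b =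
    \sum_(a <- s) dH3_pair w' a.
  rewrite big_flatten big_map; apply: eq_bigr => a _.
  by rewrite big_cons big_seq1.
split=> -[wH].
  move=> [z Fz' wmin]; split=> // w' w'H; rewrite -!sumE.
  by rewrite -!(perm_big _ (complex_roots_unique Fz' Fz)) wmin.
move=> wmin; split=> //; exists (flatten (map (@conj_pair R) s)) => // w' w'H.
by rewrite !sumE wmin.
Qed.

Lemma sum_dH3_pair_H2 s p : {in s, forall a, H2 a} -> H2 p ->
  \sum_(a <- s) dH3_pair (H2_to_H3 p) a =
  2 * (\sum_(a <- s) ln (2 * a.2) + \sum_(a <- s) ln (cdist p a)).
Proof.
move=> sH pH; rewrite -big_split mulr_sumr big_seq [RHS]big_seq.
by apply: eq_bigr => a /sH aH; rewrite dH3_pair_H2 // mulrDr.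
Qed.

Lemma sum_ln_cdist_continuous s (A : set (R * R)) :
  {in s, forall a, H2 a} -> A `<=` @H2 R ->
  {within A, continuous (fun p => \sum_(a <- s) ln (cdist p a))}.
Proof.
move=> sH AH; apply: continuous_in_subspaceT => p /set_mem/AH pH.
elim: s sH => [|a s IH] sH.
  under eq_fun do rewrite big_nil; exact: cvg_cst.
under eq_fun do rewrite big_cons.
have aH : H2 a by apply: sH; rewrite mem_head.
apply: cvgD; last by apply: IH => b bs; apply: sH; rewrite in_cons bs orbT.
apply: (@continuous_comp _ _ _ (fun p => cdist p a) (@ln R)); last first.
  by apply: continuous_ln; exact: cdist_gt0.
apply: cvgM.
  apply: cvgD; last exact: cvg_cst.
  apply: cvgD.
    by apply: cvgM; apply: cvgB; do ?exact: cvg_cst; exact: cvg_fst.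
  by apply: cvgM; exact: cvg_snd.
apply: cvgV; first by rewrite gt_eqF // !mulr_gt0.
apply: cvgM; last exact: cvg_cst.
by apply: cvgM; [exact: cvg_cst|exact: cvg_snd].
Qed.

(** Outside the ball the cost exceeds its value at p [ln_cdist_coercive].  This
    serves twice: it reduces the existence of a minimizer to the ball, and it
    places every minimizer there. *)
Lemma julia_zero_near_majority F s p (k : R) :
  stable (2 * size s) F -> uhp_roots F s -> H2 p -> 1 <= k ->
  (size s < 2 * count (fun a => cdist p a <= k)%R s)%N ->
  ((@H2_to_H3 R) @` hball p ((2 * k ^+ 2) ^+ size s)) (julia_zero F).
Proof.
move=> st Fs pH k1 maj; set r := _ ^+ _.
have sH : {in s, forall a, H2 a} := Fs.1.
have r1 : 1 <= r.
  rewrite exprn_ege1 //; have : 1 <= k ^+ 2 by rewrite exprn_ege1.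
  lra.
have s0 : (0 < size s)%N by case: (s) maj.
pose f q := \sum_(a <- s) ln (cdist q a).
have f_le q q' : H2 q -> H2 q' ->
    (\sum_(a <- s) dH3_pair (H2_to_H3 q) a <=
     \sum_(a <- s) dH3_pair (H2_to_H3 q') a) = (f q <= f q').
  by move=> qH q'H; rewrite !sum_dH3_pair_H2 // ler_pM2l // lerD2l.
have f_ball q : H2 q -> f q <= f p -> hball p r q.
  by move=> qH le_f; split=> //; exact: ln_cdist_coercive le_f.
have foot_le w : H3 w -> \sum_(a <- s) dH3_pair (H2_to_H3 (foot w)) a <=
    \sum_(a <- s) dH3_pair w a.
  move=> wH; rewrite big_seq [leRHS]big_seq; apply: ler_sum => a /sH aH.
  exact: (foot_leif wH aH).1.
(* A minimizer over the ball is a global one: compare w with its foot, and a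
   foot outside the ball with p. *)
have [w0 w0min] : exists w, julia_minimizer F w.
  have pball : hball p r p by exact: f_ball.
  have cf : {within hball p r, continuous f}.
    by apply: sum_ln_cdist_continuous sH _ => q [].
  have [c /set_mem[cH cr] cmin] := compact_EVT_min (ex_intro _ p pball)
    (hball_compact pH (lt_le_trans ltr01 r1)) cf.
  exists (H2_to_H3 c); apply/(julia_minimizer_uhp _ Fs); split=> // w wH.
  apply: le_trans (foot_le w wH); rewrite f_le //; last exact: foot_H2.
  have [le_f|lt_f] := leP (f (foot w)) (f p).
    by apply: cmin; apply/mem_set/f_ball => //; exact: foot_H2.
  by apply: le_trans (ltW lt_f); apply: cmin; exact/mem_set.
have : julia_minimizer F (julia_zero F) by apply: xgetI w0min.
move/(julia_minimizer_uhp _ Fs); move: (julia_zero F) => w [wH wmin].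
(* Otherwise some root differs from the foot of w, and the foot is strictly
   better. *)
have w_real : complex.Im w.1 = 0.
  apply/eqP/negPn/negP => y0.
  apply: (stable_not_constant (p := foot w) st Fs erefl s0) => b bs.
  apply/eqP/negPn/negP => bw.
  have := wmin _ (foot_H2 wH : H3 (H2_to_H3 (foot w))).
  apply/negP; rewrite -ltNge (perm_big _ (perm_to_rem bs)).
  rewrite [ltRHS](perm_big _ (perm_to_rem bs)) !big_cons ltr_leD //.
    rewrite (lt_leif (foot_leif wH (sH _ bs))).
    by rewrite negb_or y0.
  rewrite big_seq [leRHS]big_seq; apply: ler_sum => a /mem_rem /sH aH.
  exact: (foot_leif wH aH).1.
have wE : w = H2_to_H3 (complex.Re w.1, w.2).
  by move: w_real; case: (w) => [[x y] t] /= ->.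
exists (complex.Re w.1, w.2) => //; apply: f_ball => //.
by rewrite -f_le // -wE; exact: wmin.
Qed.

End JuliaZero.

(** * The hyperbolic zero *)

Section HyperbolicZero.
Variable R : realType.
Implicit Types (F : {mpoly R[2]}) (a q : R * R) (s : seq (R * R)).

(** The cost cdist q a is a quadratic polynomial in the coordinates of q and a,
    divided by 2 * q.2 * a.2; hence the weight 1 / a.2. *)
Definition weight s : R := \sum_(a <- s) a.2^-1.

Definition wmean s (f : R * R -> R) : R :=
  (\sum_(a <- s) f a * a.2^-1) / weight s.

Lemma weight_gt0 s : {in s, forall a, H2 a} -> s != [::] -> 0 < weight s.
Proof.
case: s => // a s sH _; rewrite /weight big_cons ltr_pwDl //.
  by rewrite invr_gt0; apply: sH; rewrite mem_head.
rewrite big_seq sumr_ge0 // => b bs.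
by rewrite invr_ge0 ltW //; apply: sH; rewrite in_cons bs orbT.
Qed.

Lemma wmean_ge0 s f : {in s, forall a, H2 a} -> {in s, forall a, 0 <= f a} ->
  0 <= wmean s f.
Proof.
move=> sH f0; rewrite /wmean /weight big_seq [in X in _ / X]big_seq.
rewrite divr_ge0 // sumr_ge0 // => a aS; last by rewrite invr_ge0 ltW ?sH.
by rewrite mulr_ge0 ?f0 // invr_ge0 ltW ?sH.
Qed.

Lemma wmean_affine s (b c : R) (f : R * R -> R) :
  {in s, forall a, H2 a} -> s != [::] ->
  wmean s (fun a => b + c * f a) = b + c * wmean s f.
Proof.
move=> sH s0; have W0 := weight_gt0 sH s0; rewrite /wmean.
have -> : \sum_(a <- s) (b + c * f a) * a.2^-1 =
    b * weight s + c * \sum_(a <- s) f a * a.2^-1.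
  rewrite /weight !mulr_sumr -big_split; apply: eq_bigr => a _ /=.
  by rewrite mulrDl mulrA.
by field; rewrite gt_eqF.
Qed.

(** When all heights lie in [lo, hi], each normalized weight is at least
    lo / (hi * size s). *)
Lemma wmean_ge_term s f b (lo hi : R) : 0 < lo ->
  {in s, forall a, lo <= a.2 <= hi} -> {in s, forall a, 0 <= f a} -> b \in s ->
  lo / (hi * (size s)%:R) * f b <= wmean s f.
Proof.
move=> lo0 sb f0 bs.
have sH : {in s, forall a, 0 < a.2}.
  by move=> a /sb/andP[+ _]; exact: lt_le_trans.
have W0 : 0 < weight s by apply: weight_gt0 => //; case: (s) bs.
have hi0 : 0 < hi by have /andP[_] := sb _ bs; apply: lt_le_trans; exact: sH.
have n0 : 0 < (size s)%:R :> R by rewrite ltr0n; case: (s) bs.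
have Wle : weight s <= (size s)%:R / lo.
  have -> : (size s)%:R / lo = \sum_(a <- s) lo^-1.
    by rewrite big_const_seq count_predT iter_addr addr0 mulr_natl.
  rewrite /weight big_seq [leRHS]big_seq.
  apply: ler_sum => a aS; rewrite lef_pV2 ?posrE ?sH //.
  by have /andP[] := sb _ aS.
have fb0 := f0 _ bs.
have termle : f b / hi <= \sum_(a <- s) f a * a.2^-1.
  rewrite (perm_big _ (perm_to_rem bs)) big_cons /=.
  rewrite ler_wpDr //; last first.
    rewrite ler_wpM2l // lef_pV2 ?posrE ?sH //.
    by have /andP[] := sb _ bs.
  rewrite big_seq sumr_ge0 // => a /mem_rem aS.
  by rewrite mulr_ge0 ?f0 // invr_ge0 ltW ?sH.
rewrite /wmean ler_pdivlMr //; apply: le_trans termle.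
have -> : f b / hi = lo / (hi * (size s)%:R) * f b * ((size s)%:R / lo).
  by field; rewrite !gt_eqF.
by rewrite ler_wpM2l // mulr_ge0 // divr_ge0 ?mulr_ge0 // ltW.
Qed.

Definition wcenter s : R := wmean s fst.

Definition wspread s : R :=
  wmean s (fun a => (a.1 - wcenter s) ^+ 2 + a.2 ^+ 2).

(** Expanding (x - a.1)^2 about the weighted mean t of the a.1, the term linear
    in x - t cancels. *)
Lemma sum_cosh_dH s q : {in s, forall a, H2 a} -> s != [::] -> H2 q ->
  \sum_(a <- s) coshR (dH q a) =
  weight s / (2 * q.2) * ((q.1 - wcenter s) ^+ 2 + q.2 ^+ 2 + wspread s).
Proof.
move=> sH s0 qH; have W0 := weight_gt0 sH s0; have q0 : 0 < q.2 := qH.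
rewrite big_seq (eq_bigr (fun a => (2 * q.2)^-1 *
   (((q.1 - wcenter s) ^+ 2 + q.2 ^+ 2 + 2 * (q.1 - wcenter s) * wcenter s)
     * a.2^-1 - 2 * (q.1 - wcenter s) * (a.1 * a.2^-1) +
    ((a.1 - wcenter s) ^+ 2 + a.2 ^+ 2) * a.2^-1))); last first.
  move=> a /sH aH; rewrite coshR_dHE // /cdist; have a0 : 0 < a.2 := aH.
  by field; rewrite !gt_eqF.
rewrite -big_seq -mulr_sumr !big_split /= sumrN -!mulr_sumr -/(weight s).
have -> : \sum_(a <- s) a.1 * a.2^-1 = wcenter s * weight s.
  by rewrite /wcenter /wmean divfK // gt_eqF.
have -> : \sum_(a <- s) ((a.1 - wcenter s) ^+ 2 + a.2 ^+ 2) * a.2^-1 =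
    wspread s * weight s.
  by rewrite /wspread /wmean divfK // gt_eqF.
by field; rewrite gt_eqF.
Qed.

(** With V = U^2, the cost at (x, y) exceeds that at (t, U) by a positive
    multiple of (x - t)^2 + (y - U)^2. *)
Lemma hyperbolic_zeroE F s : uhp_roots F s -> s != [::] ->
  hyperbolic_zero F = (wcenter s, Num.sqrt (wspread s)).
Proof.
move=> Fs s0; have sH : {in s, forall a, H2 a} := Fs.1.
have W0 := weight_gt0 sH s0.
set t := wcenter s; set V := wspread s.
have V0 : 0 < V.
  rewrite /V /wspread /wmean divr_gt0 //.
  case: (s) s0 sH => // a s' _ s'H; rewrite big_cons ltr_pwDl //.
    have a0 : 0 < a.2 by apply: s'H; rewrite mem_head.
    by rewrite mulr_gt0 ?invr_gt0 // ltr_wpDl ?sqr_ge0 // exprn_gt0.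
  rewrite big_seq sumr_ge0 // => b bs.
  have b0 : 0 < b.2 by apply: s'H; rewrite in_cons bs orbT.
  by rewrite mulr_ge0 ?addr_ge0 ?sqr_ge0 // invr_ge0 ltW.
set U := Num.sqrt V; have U0 : 0 < U by rewrite sqrtr_gt0.
have V2 : V = U ^+ 2 by rewrite sqr_sqrtr // ltW.
have UH : H2 (t, U) by [].
have gap q : H2 q ->
    \sum_(a <- s) coshR (dH q a) - \sum_(a <- s) coshR (dH (t, U) a) =
    weight s / (2 * q.2) * ((q.1 - t) ^+ 2 + (q.2 - U) ^+ 2).
  move=> qH; have q0 : 0 < q.2 := qH.
  rewrite !sum_cosh_dH // -/t -/V V2 /=; field.
  by rewrite !gt_eqF.
have factor_gt0 q : H2 q -> 0 < weight s / (2 * q.2).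
  by move=> q0; rewrite divr_gt0 // mulr_gt0.
apply: xget_unique.
  split=> //; exists s => // q qH; rewrite -subr_ge0 gap //.
  by rewrite mulr_ge0 ?addr_ge0 ?sqr_ge0 // ltW // factor_gt0.
move=> q [qH [s' Fs' qmin]].
have := qmin _ UH; rewrite !(perm_big _ (uhp_roots_unique Fs' Fs)) /=.
rewrite -subr_le0 gap // pmulr_rle0 ?factor_gt0 // => le0.
have := sqr_ge0 (q.1 - t); have := sqr_ge0 (q.2 - U) => h2 h1.
have /eqP : (q.1 - t) ^+ 2 = 0 by lra.
have /eqP : (q.2 - U) ^+ 2 = 0 by lra.
rewrite !sqrf_eq0 !subr_eq0 => /eqP e2 /eqP e1.
by rewrite -e1 -e2; case: (q).
Qed.

(** One root a at real part - M and one root b that stays behind are enough.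
    As no real part exceeds X, the weight of a gives
    X - t >= delta * (X + M); so b is at horizontal distance at least
    delta * M / 2 from t, and its weight bounds the spread from below. *)
Lemma hyperbolic_zero_escape F s a b (X lo hi M : R) :
  let delta := lo / (hi * (size s)%:R) in
  uhp_roots F s -> 0 < lo -> {in s, forall a, lo <= a.2 <= hi} ->
  {in s, forall a, `|a.1| <= M /\ a.1 <= X} ->
  a \in s -> a.1 = - M -> b \in s -> - X <= b.1 ->
  0 <= X -> 4 * X <= delta * M ->
  delta / 2 * M <= `|(hyperbolic_zero F).1| <= M
  /\ delta ^+ 2 / 2 * M <= (hyperbolic_zero F).2.
Proof.
move=> delta Fs lo0 sb sX aS aM bS bX X0 XM.
have sH : {in s, forall a, H2 a} := Fs.1.
have s0 : s != [::] by case: (s) aS.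
have hi0 : 0 < hi.
  have /andP[la ah] := sb _ aS; exact: lt_le_trans (lt_le_trans lo0 la) ah.
have n0 : 0 < (size s)%:R :> R by rewrite ltr0n; case: (s) aS.
have n1 : 1 <= (size s)%:R :> R by rewrite ler1n; case: (s) aS.
have d0 : 0 < delta by rewrite divr_gt0 ?mulr_gt0.
have d1 : delta <= 1.
  rewrite ler_pdivrMr ?mulr_gt0 // mul1r.
  have /andP[la ah] := sb _ aS; apply: (le_trans (le_trans la ah)).
  by rewrite ler_peMr // ltW.
have M0 : 0 <= M by have [+ _] := sX _ aS; apply: le_trans.
rewrite (hyperbolic_zeroE Fs s0) /=; set t := wcenter s.
have tX : delta * (X + M) <= X - t.
  have := wmean_ge_term (f := fun a => X + (-1) * a.1) lo0 sb _ aS.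
  rewrite wmean_affine // aM !mulN1r opprK; apply.
  by move=> c /sX[_ cX]; rewrite mulN1r subr_ge0.
have tM : - M <= t.
  have := @wmean_ge0 s (fun a => M + 1 * a.1) sH.
  rewrite wmean_affine // mul1r -/(wcenter s) -/t => h.
  suff : 0 <= M + t by lra.
  by apply: h => c /sX[]; rewrite mul1r ler_norml => /andP[]; lra.
have dX : 0 <= delta * X by rewrite mulr_ge0 // ltW.
have dM : 0 <= delta * M by rewrite mulr_ge0 // ltW.
have t_le : t <= X - delta * M by move: tX; rewrite mulrDr; lra.
have t0 : t <= 0 by lra.
split; first by rewrite ler0_norm //; apply/andP; split; lra.
have bt : delta * M / 2 <= b.1 - t by lra.
have V_ge : (delta ^+ 2 / 2 * M) ^+ 2 <= wspread s.
  apply: le_trans (wmean_ge_term lo0 sb _ bS); last first.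
    by move=> c _; rewrite addr_ge0 ?sqr_ge0.
  rewrite -/delta -/t; apply: (@le_trans _ _ (delta * (delta * M / 2) ^+ 2)).
    have -> : (delta ^+ 2 / 2 * M) ^+ 2 =
        delta * (delta * (delta * M / 2) ^+ 2).
      by field.
    by rewrite ler_piMl // mulr_ge0 ?sqr_ge0 // ltW.
  rewrite ler_pM2l // ler_wpDr ?sqr_ge0 // lerXn2r // ?nnegrE; lra.
rewrite -[leLHS]ger0_norm; last by rewrite mulr_ge0 ?divr_ge0 ?sqr_ge0.
by rewrite -sqrtr_sqr ler_wsqrtr.
Qed.

End HyperbolicZero.

(** * Families with escaping roots *)

Section CompactSubsets.
Variable R : realType.

(** Widening the bounds to lo <= 1 <= hi keeps them ordered when K is empty. *)
Lemma compact_H2_bounds (K : set (R * R)) : compact K -> K `<=` @H2 R ->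
  exists X lo hi : R, [/\ 0 <= X, 0 < lo, lo <= 1, 1 <= hi &
    forall p, K p -> `|p.1| <= X /\ lo <= p.2 <= hi].
Proof.
move=> cK KH; have [B [_ Bbound]] := compact_bounded cK.
pose D := Num.max 1 (B + 1).
have leD p : K p -> `|p.1| <= D /\ `|p.2| <= D.
  move=> Kp; have : `|p| <= B + 1 by apply: Bbound => //; rewrite ltrDl.
  rewrite prod_normE ge_max => /andP[h1 h2].
  by split; rewrite /D le_max ?h1 ?h2 orbT.
have D1 : 1 <= D by rewrite le_max lexx.
have [lo [lo0 lo_le]] : exists lo : R, 0 < lo /\ forall p, K p -> lo <= p.2.
  have [->|/set0P K0] := eqVneq K set0; first by exists 1; split.
  have c2 : {within K, continuous (snd : R * R -> R)}.
    by apply: continuous_in_subspaceT => p _; exact: cvg_snd.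
  have [c /set_mem/KH c0 cmin] := compact_EVT_min K0 cK c2.
  by exists c.2; split=> // p Kp; apply: cmin; exact/mem_set.
exists D, (Num.min 1 lo), D; split=> //.
- by apply: le_trans D1.
- by rewrite lt_min ltr01.
- by rewrite ge_min lexx.
- move=> p Kp; have [h1 h2] := leD p Kp; split=> //.
  by rewrite ge_min lo_le // orbT /=; apply: le_trans (ler_norm _) h2.
Qed.

End CompactSubsets.

Lemma leq_count_prefix (T : Type) n m (P : pred T) (t : n.-tuple T) :
  (m <= n)%N -> (forall i : 'I_n, (i < m)%N -> P (tnth t i)) ->
  (m <= count P t)%N.
Proof.
move=> mn tP; have sz : size (take m t) = m by rewrite size_takel ?size_tuple.
have : all P (take m t).
  case: n t mn tP sz => [|n] t mn tP sz; first by rewrite (tuple0 t).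
  apply/(all_nthP (tnth t ord0)) => i; rewrite sz => im.
  have := tP (Ordinal (leq_trans im mn)) im.
  by rewrite nth_take // (tnth_nth (tnth t ord0)).
rewrite all_count sz => /eqP cm.
by rewrite -[in leqRHS](cat_take_drop m t) count_cat cm leq_addr.
Qed.

(** The base point (0, 1) is arbitrary: K lies in a ball about it, and the m
    roots in K are a strict majority of the n upper roots. *)
Lemma julia_zero_family_compact (R : realType) (n : nat) (K : set (R * R)) :
  compact K -> K `<=` @H2 R ->
  exists K' : set (R * R),
  [/\ compact K', K' `<=` @H2 R &
    forall (m : nat) (c C : R) (F : R -> {mpoly R[2]}),
      (n < 2 * m)%N -> (m < n)%N -> 0 < c -> c <= C ->
      root_escaping_family n m K c C F ->
      forall M : R, 0 < M -> ((@H2_to_H3 R) @` K') (julia_zero (F M))].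
Proof.
move=> cK KH; have [X [lo [hi [X0 lo0 lo1 hi1 Kb]]]] := compact_H2_bounds cK KH.
pose p : R * R := (0, 1); have pH : H2 p by rewrite /H2 /=.
pose k := (X ^+ 2 + hi ^+ 2 + 1) / (2 * lo).
have k1 : 1 <= k.
  rewrite ler_pdivlMr ?mulr_gt0 // mul1r.
  have : 1 <= hi ^+ 2 by rewrite exprn_ege1.
  by have := sqr_ge0 X; lra.
have near_K q : K q -> cdist p q <= k.
  move=> Kq; have [qX /andP[qlo qhi]] := Kb q Kq; rewrite /cdist /= sub0r.
  have q0 : 0 < q.2 := lt_le_trans lo0 qlo.
  have X2 : q.1 ^+ 2 <= X ^+ 2.
    by rewrite -[leLHS]real_normK ?num_real // lerXn2r // nnegrE.
  have hi2 : q.2 ^+ 2 <= hi ^+ 2.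
    by rewrite lerXn2r // nnegrE ltW // (lt_le_trans ltr01).
  rewrite sqrrN expr1n mulr1 ler_pM //.
  - by rewrite !addr_ge0 ?sqr_ge0.
  - by rewrite invr_ge0 mulr_ge0 // ltW.
  - lra.
  - by rewrite lef_pV2 ?posrE ?mulr_gt0 // ler_pM2l.
exists (hball p ((2 * k ^+ 2) ^+ n)); split; last 1 first.
- move=> m c C F nm mn c0 cC famF M M0.
  have [_ st _ [alpha [Fs alphaK _]]] := famF M M0.
  rewrite -(size_tuple alpha) in st *.
  apply: julia_zero_near_majority => //; rewrite size_tuple.
  apply: (leq_trans nm); rewrite leq_mul2l /=.
  apply: leq_count_prefix => [|i im]; first exact: ltnW.
  by apply: near_K; exact: alphaK.
- apply: hball_compact => //; rewrite exprn_gt0 // mulr_gt0 // exprn_gt0 //.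
  exact: lt_le_trans k1.
- by move=> q [].
Qed.

Lemma hyperbolic_zero_family_growth (R : realType) (n : nat) (K : set (R * R)) :
  (0 < n)%N -> compact K -> K `<=` @H2 R ->
  forall c C : R, 0 < c -> c <= C ->
  exists c1 c2 c3 : R,
  [/\ 0 < c1, c1 < c2, 0 < c3 &
    forall (m : nat) (F : R -> {mpoly R[2]}),
      (n < 2 * m)%N -> (m < n)%N ->
      root_escaping_family n m K c C F ->
      \forall M \near +oo,
        c1 * M <= `|(hyperbolic_zero (F M)).1| <= c2 * M
        /\ c3 * M <= (hyperbolic_zero (F M)).2].
Proof.
move=> n0 cK KH; have nR1 : 1 <= n%:R :> R by rewrite ler1n.
have nR0 : 0 < n%:R :> R by rewrite ltr0n.
have [X [lo [hi [X0 lo0 lo1 hi1 Kb]]]] := compact_H2_bounds cK KH.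
move=> c C c0 cC.
(* Bounds for the heights of all roots, in K or escaping. *)
pose lo' := Num.min lo c; pose hi' := Num.max hi C.
have lo'0 : 0 < lo' by rewrite lt_min lo0.
have hi'1 : 1 <= hi' by rewrite le_max hi1.
have lo'1 : lo' <= 1 by rewrite ge_min lo1.
have hi'0 : 0 < hi' := lt_le_trans ltr01 hi'1.
pose delta := lo' / (hi' * n%:R).
have d0 : 0 < delta by rewrite divr_gt0 ?mulr_gt0.
have d1 : delta <= 1.
  rewrite ler_pdivrMr ?mulr_gt0 // mul1r (le_trans lo'1) //.
  by rewrite mulr_ege1.
exists (delta / 2), 1, (delta ^+ 2 / 2); split.
- by rewrite divr_gt0.
- lra.
- by rewrite divr_gt0 ?exprn_gt0.
move=> m F nm mn famF; near=> M.
have M0 : 0 < M by near: M; exact: nbhs_pinfty_gt.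
have MX : X <= M by near: M; exact: nbhs_pinfty_ge (num_real _).
have MdX : 4 * X <= delta * M.
  rewrite -ler_pdivrMl //; near: M; exact: nbhs_pinfty_ge (num_real _).
have [_ _ _ [alpha [Fs alphaK alphaM]]] := famF M M0.
have m0 : (0 < m)%N by case: (m) nm.
have /alphaM[farM _] : (m <= Ordinal mn)%N by [].
have [/ler_normlP[nearX _] _] := Kb _ (alphaK (Ordinal n0) m0).
rewrite mul1r /delta -(size_tuple alpha).
apply: (hyperbolic_zero_escape (X := X) (M := M) Fs lo'0 _ _
  (mem_tnth _ _) farM (mem_tnth (Ordinal n0) alpha) _ X0).
- move=> a /tnthP[i ->]; rewrite ge_min le_max.
  have [im|mi] := ltnP i m.
    by have [_ /andP[-> ->]] := Kb _ (alphaK i im).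
  by have [_ /andP[-> ->]] := alphaM i mi; rewrite !orbT.
- move=> a /tnthP[i ->]; have [im|mi] := ltnP i m.
    have [aX _] := Kb _ (alphaK i im); split; first exact: le_trans MX.
    exact: le_trans (ler_norm _) aX.
  have [-> _] := alphaM i mi; rewrite normrN (gtr0_norm M0); split=> //.
  by apply: (le_trans _ X0); rewrite oppr_le0 ltW.
- by rewrite lerNl.
- by rewrite size_tuple; exact: MdX.
Unshelve. all: by end_near.
Qed.

Theorem proposition16 (R : realType) (n : nat) (K : set (R * R)) :
  (3 <= n)%N -> compact K -> K `<=` @H2 R ->
  (exists K' : set (R * R),
    [/\ compact K', K' `<=` @H2 R &
      forall (m : nat) (c C : R) (F : R -> {mpoly R[2]}),
        (n < 2 * m)%N -> (m < n)%N -> 0 < c -> c <= C ->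
        root_escaping_family n m K c C F ->
        forall M : R, 0 < M -> ((@H2_to_H3 R) @` K') (julia_zero (F M))])
  /\
  (forall c C : R, 0 < c -> c <= C ->
    exists c1 c2 c3 : R,
    [/\ 0 < c1, c1 < c2, 0 < c3 &
      forall (m : nat) (F : R -> {mpoly R[2]}),
        (n < 2 * m)%N -> (m < n)%N ->
        root_escaping_family n m K c C F ->
        \forall M \near +oo,
          c1 * M <= `|(hyperbolic_zero (F M)).1| <= c2 * M
          /\ c3 * M <= (hyperbolic_zero (F M)).2])
  /\
  (forall (m : nat) (c C : R) (F : R -> {mpoly R[2]}),
    (n < 2 * m)%N -> (m < n)%N -> 0 < c -> c <= C ->
    root_escaping_family n m K c C F ->
    (julia_zero (F M)).2 / (hyperbolic_zero (F M)).2 @[M --> +oo] --> (0 : R)).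
Proof.
move=> n3 cK KH; have n0 : (0 < n)%N by apply: leq_trans n3.
have part1 := @julia_zero_family_compact R n K cK KH.
have part2 := @hyperbolic_zero_family_growth R n K n0 cK KH.
split=> //; split=> // m c C F nm mn c0 cC famF.
have [K' [cK' K'H julia_K']] := part1.
have [X' [lo' [B [_ _ _ _ K'b]]]] := compact_H2_bounds cK' K'H.
have [c1 [c2 [c3 [_ _ c30 hyp]]]] := part2 c C c0 cC.
apply/cvgrPdist_le => e e0; near=> M.
have M0 : 0 < M by near: M; exact: nbhs_pinfty_gt.
have Me : B / (e * c3) <= M by near: M; exact: nbhs_pinfty_ge (num_real _).
have [_ c3M] : c1 * M <= `|(hyperbolic_zero (F M)).1| <= c2 * M
    /\ c3 * M <= (hyperbolic_zero (F M)).2.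
  by near: M; exact: hyp famF.
have [q K'q <-] := julia_K' m c C F nm mn c0 cC famF M M0.
have q0 : 0 < q.2 by exact: K'H.
have [_ /andP[_ qB]] := K'b q K'q.
have u0 : 0 < (hyperbolic_zero (F M)).2.
  by apply: lt_le_trans c3M; rewrite mulr_gt0.
rewrite sub0r normrN gtr0_norm ?divr_gt0 //= ler_pdivrMr //.
apply: (le_trans qB); apply: le_trans (ler_wpM2l (ltW e0) c3M).
by rewrite mulrA -ler_pdivrMl ?mulr_gt0 // mulrC.
Unshelve. all: by end_near.
Qed.
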